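(* There is a sentence $L$ of £ such that $\Vdash^M L\leftrightarrow\neg\mathcal T\ulcorner L\urcorner$; namely $L\equiv r\notin r$ where $r=\{x\mid x\notin x\}$.
   Context: The language of the librationist theory £: variables; primitive set constants $\mathcal T$ (truth set) and $\mathcal F$; atomic formulas $a\in b$; formulas $\downarrow AB$ (joint denial), $\forall vA$; terms $\{v\mid A\}$; name terms $\ulcorner X\urcorner$. $\neg A:=\downarrow AA$, $a\notin b:=\neg a\in b$, other connectives and $\exists$ classical; $\mathcal T\ulcorner A\urcorner$ is the formula $\ulcorner A\urcorner\in\mathcal T$. Semantics: for each $n\in\omega$ and ordinal $\alpha$ a full set $\models^\alpha_n$ of formulas ($\downarrow AB$ in it iff neither $A$ nor $B$; $\forall vA$ in it iff all substitution instances $A^b_v$ are); $(\models^0_n)_n$ a fixed enumeration of full sets; for $\alpha>0$, $\mathcal T\ulcorner A\urcorner\in\models^\alpha_n$ iff for some $\gamma<\alpha$, $A\in\models^\delta_n$ for all $\gamma\le\delta<\alpha$, and $a\in\{x\mid A\}\in\models^\alpha_n$ iff $\mathcal T\ulcorner A^a_x\urcorner\in\models^\alpha_n$. $\models^\alpha B$ iff $B\in\models^\alpha_n$ for all $n$. $\mathrm{IN}^\alpha(A)$ iff $\models^\beta\mathcal T\ulcorner A\urcorner$ for all $\beta\ge\alpha$; $\mathrm{IN}(A)$ iff $\exists\alpha\,\mathrm{IN}^\alpha(A)$; $\alpha$ stabilizes $A$ iff ($\mathrm{IN}(A)\Rightarrow\mathrm{IN}^\alpha(A)$) and ($\models^\alpha\mathcal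 T\ulcorner A\urcorner\Rightarrow\mathrm{IN}(A)$); $\varpi$ is the least ordinal stabilizing every sentence. $\Vdash^MA$ iff $\mathcal T\ulcorner A\urcorner\in\models^\varpi_n$ for all $n$. *)

(* Defs.v *)
From Stdlib Require Import Arith ClassicalEpsilon.

Definition var := nat.

(** A name term [⌜X⌝] may name a formula or a term. *)
Inductive term : Type :=
  | Var (v : var)
  | TrueSet
  | FalseSet
  | Compr (v : var) (A : formula)
  | NameF (A : formula)
  | NameT (a : term)
with formula : Type :=
  | Mem (a b : term)
  | Nor (A B : formula)
  | All (v : var) (A : formula).

Definition Not (A : formula) : formula := Nor A A.
Definition Or (A B : formula) : formula := Not (Nor A B).
Definition And (A B : formula) : formula := Nor (Not A) (Not B).
Definition Imp (A B : formula) : formula := Or (Not A) B.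
Definition Iff (A B : formula) : formula := And (Imp A B) (Imp B A).
Definition NotMem (a b : term) : formula := Not (Mem a b).
Definition Tr (A : formula) : formula := Mem (NameF A) TrueSet.

(** Names are transparent: the free variables of [X] are free in [⌜X⌝] and
    substitution acts inside names, as is needed for quantifying into
    [T⌜A⌝], e.g. in [∀x (x ∈ {y | A} ↔ T⌜A^x_y⌝)]. *)
Fixpoint free_in_term (v : var) (a : term) : Prop :=
  match a with
  | Var w => v = w
  | TrueSet | FalseSet => False
  | Compr w A => v <> w /\ free_in v A
  | NameF A => free_in v A
  | NameT b => free_in_term v b
  end
with free_in (v : var) (A : formula) : Prop :=
  match A with
  | Mem a b => free_in_term v a \/ free_in_term v b
  | Nor B C => free_in v B \/ free_in v C
  | All w B => v <> w /\ free_in v B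
  end.

Definition is_sentence (A : formula) : Prop := forall v, ~ free_in v A.

Fixpoint subst_term (v : var) (b : term) (a : term) : term :=
  match a with
  | Var w => if Nat.eq_dec v w then b else Var w
  | TrueSet => TrueSet
  | FalseSet => FalseSet
  | Compr w A => Compr w (if Nat.eq_dec v w then A else subst v b A)
  | NameF A => NameF (subst v b A)
  | NameT c => NameT (subst_term v b c)
  end
with subst (v : var) (b : term) (A : formula) : formula :=
  match A with
  | Mem a c => Mem (subst_term v b a) (subst_term v b c)
  | Nor B C => Nor (subst v b B) (subst v b C)
  | All w B => All w (if Nat.eq_dec v w then B else subst v b B)
  end.

(** [b] is substitutable for [v]: no free variable of [b] gets captured. *)
Fixpoint free_for_term (b : term) (v : var) (a : term) : Prop :=
  match a with
  | Var _ | TrueSet | FalseSet => True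
  | Compr w A => ~ (v <> w /\ free_in v A)
                 \/ (~ free_in_term w b /\ free_for b v A)
  | NameF A => free_for b v A
  | NameT c => free_for_term b v c
  end
with free_for (b : term) (v : var) (A : formula) : Prop :=
  match A with
  | Mem a c => free_for_term b v a /\ free_for_term b v c
  | Nor B C => free_for b v B /\ free_for b v C
  | All w B => ~ (v <> w /\ free_in v B)
               \/ (~ free_in_term w b /\ free_for b v B)
  end.

(** Ordinals as well-founded trees: [osup f] is the least ordinal strictly
    above every [f i]. Equality of ordinals is [oeq], not Leibniz equality. *)
Inductive Ord : Type := osup (X : Type) (f : X -> Ord).

Fixpoint ole (a b : Ord) : Prop :=
  match a with
  | osup X f =>
      forall i : X, match b with osup Y g => exists j : Y, ole (f i) (g j) end
  end.

Definition olt (a b : Ord) : Prop :=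
  match b with osup Y g => exists j : Y, ole a (g j) end.

Definition oeq (a b : Ord) : Prop := ole a b /\ ole b a.

Definition ozero : Ord := osup Empty_set (fun e => match e with end).

Definition full (S : formula -> Prop) : Prop :=
  (forall A B, S (Nor A B) <-> ~ S A /\ ~ S B) /\
  (forall v A, S (All v A) <-> forall b, free_for b v A -> S (subst v b A)).

(** [sat n α] is the set [⊨^α_n]. At [α = 0] it is any sequence of full sets;
    at [α > 0] the atoms not covered by the two clauses are left arbitrary. *)
Record semantics : Type := {
  sat : nat -> Ord -> formula -> Prop;
  sat_ext : forall n alpha beta A,
    oeq alpha beta -> sat n alpha A -> sat n beta A;
  sat_full : forall n alpha, full (sat n alpha);
  sat_Tr : forall n alpha A, olt ozero alpha ->
    (sat n alpha (Tr A) <->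
     exists gamma, olt gamma alpha /\
       forall delta, ole gamma delta -> olt delta alpha -> sat n delta A);
  sat_Compr : forall n alpha a x A, olt ozero alpha -> free_for a x A ->
    (sat n alpha (Mem a (Compr x A)) <-> sat n alpha (Tr (subst x a A)))
}.

Definition models (M : semantics) (alpha : Ord) (A : formula) : Prop :=
  forall n, sat M n alpha A.

Definition IN_from (M : semantics) (alpha : Ord) (A : formula) : Prop :=
  forall beta, ole alpha beta -> models M beta (Tr A).

Definition IN (M : semantics) (A : formula) : Prop :=
  exists alpha, IN_from M alpha A.

Definition stabilizes (M : semantics) (alpha : Ord) (A : formula) : Prop :=
  (IN M A -> IN_from M alpha A) /\ (models M alpha (Tr A) -> IN M A).

Definition stabilizes_all (M : semantics) (alpha : Ord) : Prop :=
  forall A, is_sentence A -> stabilizes M alpha A.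

Definition is_least_stabilizing (M : semantics) (alpha : Ord) : Prop :=
  stabilizes_all M alpha /\
  forall beta, stabilizes_all M beta -> ole alpha beta.

(** The least stabilizing ordinal, unique up to [oeq]; [ozero] is only the
    inhabitant required by [epsilon]. *)
Definition varpi (M : semantics) : Ord :=
  epsilon (inhabits ozero) (is_least_stabilizing M).

Definition forces (M : semantics) (A : formula) : Prop :=
  forall n, sat M n (varpi M) (Tr A).

Definition russell (x : var) : term := Compr x (NotMem (Var x) (Var x)).

(* Main.v *)
From Stdlib Require Import Arith Classical ClassicalEpsilon.
Require Import Defs.

(** At every [α > 0] the comprehension clause makes [r ∈ r] equivalent to
    [T⌜r ∉ r⌝], so [L ↔ ¬T⌜L⌝] holds at all [α >= 1] and is in [IN]. An ordinal
    stabilizing every sentence therefore validates [T⌜L ↔ ¬T⌜L⌝⌝], even if it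
    is [0] or [1]. What is left is that the least stabilizing ordinal exists, so
    that [varpi] is not a junk value of [epsilon]. If [A] is not in [IN], some
    fixed [n] refutes [A] at arbitrarily large ordinals, because countably many
    bounds have a supremum. A limit of an [ω]-chain that starts above the
    witnesses of all [IN] formulas, and catches a new refutation of every
    other formula at each step, stabilizes every formula. *)

Lemma ole_refl (a : Ord) : ole a a.
Proof. induction a as [X f IH]; intros i; exists i; apply IH. Qed.

Lemma ole_trans (a b c : Ord) : ole a b -> ole b c -> ole a c.
Proof.
  revert b c; induction a as [X f IH]; intros [Y g] [Z h] ab bc i.
  destruct (ab i) as [j fg]; destruct (bc j) as [k gh].
  exists k; exact (IH i _ _ fg gh).
Qed.

Lemma olt_ole_trans (a b c : Ord) : olt a b -> ole b c -> olt a c.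
Proof.
  destruct b as [Y g], c as [Z h]; intros [j ag] bc.
  destruct (bc j) as [k gh]; exists k; exact (ole_trans _ _ _ ag gh).
Qed.

Lemma ole_olt_trans (a b c : Ord) : ole a b -> olt b c -> olt a c.
Proof.
  destruct c as [Z h]; intros ab [k bh]; exists k; exact (ole_trans _ _ _ ab bh).
Qed.

Lemma olt_ole (a b : Ord) : olt a b -> ole a b.
Proof.
  revert b; induction a as [X f IH]; intros [Y g] [j ag] i.
  exists j; apply IH; apply olt_ole_trans with (osup X f); [|exact ag].
  exists i; apply ole_refl.
Qed.

Lemma olt_osup (X : Type) (f : X -> Ord) (i : X) : olt (f i) (osup X f).
Proof. exists i; apply ole_refl. Qed.

Lemma ole_osup (X : Type) (f : X -> Ord) (i : X) : ole (f i) (osup X f).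
Proof. apply olt_ole, olt_osup. Qed.

Lemma ole_ozero (a : Ord) : ole ozero a.
Proof. destruct a; intros []. Qed.

(** Classically, either every [f i] is below [b], or some [f i] is not, and then induction puts
    every [g j] strictly below that [f i]. *)
Lemma ole_or_olt (a b : Ord) : ole a b \/ olt b a.
Proof.
  revert b; induction a as [X f IH]; intros [Y g].
  destruct (classic (forall i, olt (f i) (osup Y g))) as [all|nall].
  - left; exact all.
  - right; apply not_all_ex_not in nall as [i ni]; exists i.
    intros j; destruct (IH i (g j)) as [le|lt]; [|exact lt].
    contradict ni; exists j; exact le.
Qed.

Lemma olt_wf : well_founded olt.
Proof.
  (* An ordinal below [osup X f] is only [ole] some [f i], not equal to it, so the induction must
     cover everything [ole] to [a]. *)
  intros a; cut (forall b, ole b a -> Acc olt b).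
  { intros H; apply H, ole_refl. }
  induction a as [X f IH]; intros b ba; constructor; intros c cb.
  destruct (olt_ole_trans _ _ _ cb ba) as [i ci]; exact (IH i c ci).
Qed.

Lemma ex_least_Ord (P : Ord -> Prop) :
  (exists a, P a) -> exists a, P a /\ forall b, P b -> ole a b.
Proof.
  intros [a Pa]; revert Pa; induction a as [a IH] using (well_founded_ind olt_wf).
  intros Pa; destruct (classic (exists b, olt b a /\ P b)) as [[b [ba Pb]]|no].
  - exact (IH b ba Pb).
  - exists a; split; [exact Pa|]; intros b Pb.
    destruct (ole_or_olt a b) as [le|lt]; [exact le|].
    contradict no; exists b; split; assumption.
Qed.

Section Stabilization.

Variable M : semantics.

Definition recurrently_fails (n : nat) (A : formula) : Prop :=
  forall a, exists b, ole a b /\ ~ sat M n b A.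

Lemma IN_of_eventually (A : formula) (a : Ord) :
  (forall n b, ole a b -> sat M n b A) -> IN M A.
Proof.
  (* The successor of [a]: [T⌜A⌝] at [b] needs a [gamma] strictly below [b], and [a] serves. *)
  intros H; exists (osup unit (fun _ => a)); intros b ab n.
  assert (a_lt_b : olt a b) by exact (ab tt).
  apply sat_Tr; [exact (ole_olt_trans _ _ _ (ole_ozero a) a_lt_b)|].
  exists a; split; [exact a_lt_b|]; intros d ad _; exact (H n d ad).
Qed.

Lemma IN_or_recurrently_fails (A : formula) :
  IN M A \/ exists n, recurrently_fails n A.
Proof.
  destruct (classic (exists n, recurrently_fails n A)) as [ex|nex]; [right; exact ex|].
  left.
  assert (bd : forall n, exists a, forall b, ole a b -> sat M n b A).
  { intros n; apply NNPP; intros nbd; apply nex; exists n; intros a.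
    apply NNPP; intros nb; apply nbd; exists a; intros b ab.
    apply NNPP; intros nsat; apply nb; exists b; split; assumption. }
  set (bound n := proj1_sig (constructive_indefinite_description _ (bd n))).
  apply IN_of_eventually with (osup nat bound); intros n b le.
  apply (proj2_sig (constructive_indefinite_description _ (bd n))).
  exact (ole_trans _ _ _ (ole_osup nat bound n) le).
Qed.

(** For [A] outside [IN] the chosen ordinal is arbitrary; this is harmless, as it can only raise the
    supremum. *)
Definition IN_bound : Ord :=
  osup formula (fun A => epsilon (inhabits ozero) (fun a => IN_from M a A)).

(** One step passes failures of all pairs of an index and a formula at once, so the chain needs no
    enumeration of formulas. *)
Definition next_failures (a : Ord) : Ord :=
  osup (nat * formula)
    (fun p => epsilon (inhabits a)
                (fun b => ole a b /\ ~ sat M (fst p) b (snd p))).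

Definition stable_chain (k : nat) : Ord := Nat.iter k next_failures IN_bound.

Definition stable_limit : Ord := osup nat stable_chain.

Lemma stable_limit_stabilizes (A : formula) : stabilizes M stable_limit A.
Proof.
  split.
  - intros inA b le; apply (epsilon_spec (inhabits ozero) _ inA).
    apply ole_trans with IN_bound.
    { exact (ole_osup formula
               (fun A => epsilon (inhabits ozero) (fun a => IN_from M a A)) A). }
    apply ole_trans with stable_limit; [exact (ole_osup nat stable_chain 0)|exact le].
  - intros trA; destruct (IN_or_recurrently_fails A) as [inA|[n rec]]; [exact inA|].
    exfalso; specialize (trA n); apply sat_Tr in trA.
    2: exists 0; apply ole_ozero.
    (* [A] holds from [c] up to the limit, and [c] is at most stage [k]; but stage [S k] lies above
       a failure of [A] that is at or past stage [k]. *)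
    destruct trA as [c [[k ck] Hc]].
    set (a := stable_chain k) in *.
    set (P := fun p : nat * formula =>
                fun b => ole a b /\ ~ sat M (fst p) b (snd p)).
    destruct (epsilon_spec (inhabits a) (P (n, A)) (rec a)) as [ab nsat].
    apply nsat, Hc; [exact (ole_trans _ _ _ ck ab)|].
    exists (S k).
    exact (ole_osup _ (fun p => epsilon (inhabits a) (P p)) (n, A)).
Qed.

Lemma varpi_stabilizes_all : stabilizes_all M (varpi M).
Proof.
  assert (ex : exists a, is_least_stabilizing M a).
  { apply ex_least_Ord; exists stable_limit; intros A _.
    apply stable_limit_stabilizes. }
  exact (proj1 (epsilon_spec (inhabits ozero) _ ex)).
Qed.

Lemma forces_of_IN (A : formula) : is_sentence A -> IN M A -> forces M A.
Proof.
  intros closed inA.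
  exact (proj1 (varpi_stabilizes_all A closed) inA _ (ole_refl _)).
Qed.

Lemma sat_Not (n : nat) (a : Ord) (A : formula) :
  sat M n a (Not A) <-> ~ sat M n a A.
Proof.
  unfold Not; rewrite (proj1 (sat_full M n a)); tauto.
Qed.

Lemma sat_Iff (n : nat) (a : Ord) (A B : formula) :
  sat M n a (Iff A B) <-> (sat M n a A <-> sat M n a B).
Proof.
  unfold Iff, And, Imp, Or.
  repeat (rewrite (proj1 (sat_full M n a)) || rewrite sat_Not).
  destruct (classic (sat M n a A)), (classic (sat M n a B)); tauto.
Qed.

Lemma sat_russell_mem (n : nat) (a : Ord) (x : var) :
  olt ozero a ->
  sat M n a (Mem (russell x) (russell x)) <->
  sat M n a (Tr (NotMem (russell x) (russell x))).
Proof.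
  intros pos.
  assert (E : subst x (russell x) (NotMem (Var x) (Var x)) =
              NotMem (russell x) (russell x)).
  { cbn; destruct (Nat.eq_dec x x) as [_|ne]; [reflexivity|now contradict ne]. }
  rewrite <- E; apply sat_Compr; [exact pos|cbn; tauto].
Qed.

End Stabilization.

Theorem theorem13p0p1 (x : var) :
  exists L : formula,
    is_sentence L /\
    L = NotMem (russell x) (russell x) /\
    forall M : semantics, forces M (Iff L (Not (Tr L))).
Proof.
  exists (NotMem (russell x) (russell x)).
  split; [intros v; cbn; tauto|split; [reflexivity|]].
  intros M; apply forces_of_IN; [intros v; cbn; tauto|].
  (* Start at 1: the truth and comprehension clauses say nothing at 0. *)
  apply IN_of_eventually with (osup unit (fun _ => ozero)); intros n b le.
  rewrite sat_Iff, sat_Not; unfold NotMem at 1.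
  rewrite sat_Not, sat_russell_mem; [reflexivity|exact (le tt)].
Qed.
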